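(* Let $f:\mathbb{R}^{n\times n}\to\mathbb{R}$ be convex, differentiable, symmetric, $M$-smooth and $m$-strongly convex with $m>0$, and $\kappa=M/m$. Let $X^\star$ be the minimizer of $f$ over $\mathbb{S}^n_+$, $r\le\mathrm{rank}(X^\star)$, $X^\star_r$ its best rank-$r$ approximation, and $U^\star_r\in\mathbb{R}^{n\times r}$ with $X^\star_r=U^\star_r(U^\star_r)^\top$. Define $$X^0:=\frac{1}{\|\nabla f(0)-\nabla f(e_1e_1^\top)\|_F}\,\mathcal{P}_+\big(-\nabla f(0)\big),$$ let $X^0_r$ be its best rank-$r$ approximation and $U^0\in\mathbb{R}^{n\times r}$ with $U^0(U^0)^\top=X^0_r$. Suppose $\|X^\star-X^\star_r\|_F\le\tilde\rho\,\|X^\star_r\|_2$ for some $\tilde\rho\ge0$. Then $\mathrm{Dist}(U^0,U^\star_r)\le\gamma\,\sigma_r(U^\star_r)$, where $$\gamma=4\,\tau(X^\star_r)\sqrt{2r}\Big(\sqrt{\kappa^2-\tfrac{2}{\kappa}+1}\,\big(\mathrm{srank}(X^\star_r)^{1/2}+\tilde\rho\big)+\tilde\rho\Big),\qquad \mathrm{srank}(X^\star_r)=\frac{\|X^\star_r\|_F^2}{\|X^\star_r\|_2^2}.$$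
   Context: $\mathbb{S}^n_+$ is the cone of $n\times n$ positive semidefinite matrices; $\mathcal{P}_+(Y)$ is the projection of a symmetric matrix $Y$ onto $\mathbb{S}^n_+$, i.e. $\sum_{i:\lambda_i>0}\lambda_iv_iv_i^\top$ for an eigendecomposition $Y=\sum_i\lambda_iv_iv_i^\top$. $e_1$ is the first standard basis vector. For a matrix $A$, $\sigma_i(A)$ is its $i$-th largest singular value, $\|A\|_2=\sigma_1(A)$, $\|A\|_F$ the Frobenius norm, $\langle A,B\rangle=\mathrm{tr}(A^\top B)$. For a rank-$r$ PSD matrix $Z$, $\tau(Z)=\sigma_1(Z)/\sigma_r(Z)$. Best rank-$r$ approximations are by truncated eigenvalue decomposition. For $U,V\in\mathbb{R}^{n\times r}$, $\mathrm{Dist}(U,V)=\min_{R\in\mathcal{O}_r}\|U-VR\|_F$, $\mathcal{O}_r$ the $r\times r$ orthogonal matrices. $f$ symmetric means $f(X)=f(X^\top)$. $M$-smooth: $\|\nabla f(X)-\nabla f(Y)\|_F\le M\|X-Y\|_F$ for all $X,Y\in\mathbb{S}^n_+$. $m$-strongly convex: $f(Y)\ge f(X)+\langle\nabla f(X),Y-X\rangle+\frac m2\|Y-X\|_F^2$ for all $X,Y\in\mathbb{S}^n_+$. *)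

(* Defs.v *)
From Stdlib Require Import Reals ClassicalEpsilon.
From mathcomp Require Import all_boot.
Set Implicit Arguments.
Unset Strict Implicit.
Unset Printing Implicit Defensive.

Open Scope R_scope.

Definition Mat (p q : nat) := 'I_p -> 'I_q -> R.

Definition rsum (k : nat) (F : 'I_k -> R) : R := \big[Rplus/0]_(i < k) F i.

Definition mmul {p q s} (A : Mat p q) (B : Mat q s) : Mat p s :=
  fun i j => rsum (fun k => A i k * B k j).
Definition mtr {p q} (A : Mat p q) : Mat q p := fun i j => A j i.
Definition madd {p q} (A B : Mat p q) : Mat p q := fun i j => A i j + B i j.
Definition msub {p q} (A B : Mat p q) : Mat p q := fun i j => A i j - B i j.
Definition mopp {p q} (A : Mat p q) : Mat p q := fun i j => - A i j.
Definition mscale {p q} (c : R) (A : Mat p q) : Mat p q := fun i j => c * A i j.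
Definition mzero {p q} : Mat p q := fun _ _ => 0.
Definition mid (k : nat) : Mat k k := fun i j => if i == j then 1 else 0.
Definition mdiag {k} (l : 'I_k -> R) : Mat k k := fun i j => if i == j then l i else 0.
Definition e11 (k : nat) : Mat k k :=
  fun i j => if (nat_of_ord i == 0%nat) && (nat_of_ord j == 0%nat) then 1 else 0.

Definition meq {p q} (A B : Mat p q) : Prop := forall i j, A i j = B i j.

Definition finner {p q} (A B : Mat p q) : R :=
  rsum (fun i => rsum (fun j => A i j * B i j)).
Definition frob {p q} (A : Mat p q) : R := sqrt (finner A A).

Definition is_sym {k} (A : Mat k k) : Prop := forall i j, A i j = A j i.
Definition is_psd {k} (A : Mat k k) : Prop :=
  is_sym A /\ forall v : 'I_k -> R, 0 <= rsum (fun i => rsum (fun j => v i * A i j * v j)).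
Definition is_orth {k} (V : Mat k k) : Prop := meq (mmul (mtr V) V) (@mid k).

Definition is_eigdec {k} (S V : Mat k k) (l : 'I_k -> R) : Prop :=
  is_orth V /\ meq S (mmul (mmul V (mdiag l)) (mtr V)).
Definition nonincr {k} (l : 'I_k -> R) : Prop :=
  forall i j : 'I_k, (i <= j)%N -> l j <= l i.

Definition is_psd_proj {k} (Y P : Mat k k) : Prop :=
  exists V l, is_eigdec Y V l /\
    meq P (mmul (mmul V (mdiag (fun i => if Rlt_dec 0 (l i) then l i else 0))) (mtr V)).

Definition is_best_rank_approx {k} (rr : nat) (Z Zr : Mat k k) : Prop :=
  exists V l, is_eigdec Z V l /\ nonincr l /\
    meq Zr (mmul (mmul V (mdiag (fun i => if (i < rr)%N then l i else 0))) (mtr V)).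

Definition rank_ge {p q} (A : Mat p q) (rr : nat) : Prop :=
  exists c : 'I_rr -> 'I_q,
    forall a : 'I_rr -> R,
      (forall i, rsum (fun t => a t * A i (c t)) = 0) -> forall t, a t = 0.

Definition eigvals {k} (S : Mat k k) : 'I_k -> R :=
  epsilon (inhabits (fun _ => 0)) (fun l => exists V, is_eigdec S V l /\ nonincr l).

(* sigma_i(A), 1-based: sqrt of i-th largest eigenvalue of A^T A (0 if out of range) *)
Definition sv {p q} (A : Mat p q) (i : nat) : R :=
  match (insub i.-1 : option 'I_q) with
  | Some t => sqrt (eigvals (mmul (mtr A) A) t)
  | None => 0
  end.
Definition opnorm {p q} (A : Mat p q) : R := sv A 1.

Definition tau {k} (Z : Mat k k) (rr : nat) : R := sv Z 1 / sv Z rr.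
Definition srank {k} (Z : Mat k k) : R := (frob Z) ^ 2 / (opnorm Z) ^ 2.

Definition Dist {p k} (U V : Mat p k) : R :=
  epsilon (inhabits 0)
    (fun d => (exists Q, is_orth Q /\ d = frob (msub U (mmul V Q))) /\
              forall Q, is_orth Q -> d <= frob (msub U (mmul V Q))).

Definition is_gradient {k} (f : Mat k k -> R) (g : Mat k k -> Mat k k) : Prop :=
  forall X eps, 0 < eps -> exists delta, 0 < delta /\
    forall H, frob H < delta ->
      Rabs (f (madd X H) - f X - finner (g X) H) <= eps * frob H.

Definition convex_fun {k} (f : Mat k k -> R) : Prop :=
  forall X Y t, 0 <= t <= 1 ->
    f (madd (mscale t X) (mscale (1 - t) Y)) <= t * f X + (1 - t) * f Y.
Definition sym_fun {k} (f : Mat k k -> R) : Prop := forall X, f X = f (mtr X).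
Definition smooth_on_psd {k} (M : R) (g : Mat k k -> Mat k k) : Prop :=
  forall X Y, is_psd X -> is_psd Y -> frob (msub (g X) (g Y)) <= M * frob (msub X Y).
Definition strongly_convex_on_psd {k} (m : R) (f : Mat k k -> R) (g : Mat k k -> Mat k k) : Prop :=
  forall X Y, is_psd X -> is_psd Y ->
    f Y >= f X + finner (g X) (msub Y X) + m / 2 * (frob (msub Y X)) ^ 2.

(* Main.v *)
(** Initialization error. Optimality of [Xs] over the PSD cone makes
    [<G Xs, H>] nonnegative in every feasible direction [H]; with [H = P] and
    smoothness this gives [|P| <= M |Xs|], and with [H = - Xs] and strong
    convexity it gives [<P, Xs> >= m |Xs|^2].  The step length [D] lies in
    [[m, M]], so expanding [|P / D - Xs|^2] yields the factor
    [kappa^2 - 2 / kappa + 1].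

    Truncation. By Eckart-Young [|X0 - X0r| <= |X0 - Xsr|], hence
    [|X0r - Xsr| <= 2 |X0 - Xsr|].

    Passage to factors. Write [U] for [U0] and [V] for [Usr], let [Q] be an
    orthogonal matrix minimizing [|U - V Q|] and [W = V Q]; then [U^T W] is symmetric positive semidefinite.  With
    [A = U - W] and [B = U + W] one has
    [2 (U U^T - W W^T) = A B^T + B A^T], where [<A B^T, B A^T> = |A^T B|^2 >= 0]
    and [B^T B >= W^T W], so [sigma_r(V)^2 |A|^2 <= 2 |U U^T - V V^T|^2]. *)

Require Import Defs.
From Stdlib Require Import Reals ClassicalEpsilon.
From mathcomp Require Import all_boot all_order all_algebra.
From mathcomp Require Import boolp classical_sets set_interval reals topology.
From mathcomp Require Import normedtype derive Rstruct ring lra.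
Set Implicit Arguments.
Unset Strict Implicit.
Unset Printing Implicit Defensive.
Import Order.TTheory GRing.Theory Num.Theory numFieldNormedType.Exports.
Local Open Scope ring_scope.

(** * Frobenius inner product and the orthogonal Procrustes problem *)

(** The orthogonal group is compact and the trace is continuous, so a maximum is attained. This is
    what makes the minimum in [Dist] exist. *)
Lemma orthogonal_trace_max (R : realType) (r : nat) (N : 'M[R]_r) :
  exists2 Q : 'M[R]_r, Q^T *m Q = 1%:M
    & forall G : 'M[R]_r, G^T *m G = 1%:M -> \tr (N *m G) <= \tr (N *m Q).
Proof.
pose A := [set v : 'rV[R]_(r * r) | (vec_mx v)^T *m vec_mx v = 1%:M]%classic.
have A0 : (A !=set0)%classic.
  by exists (mxvec 1%:M); rewrite /A /= mxvecK trmx1 mulmx1.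
have cont_vec i j : continuous (fun v : 'rV[R]_(r * r) => vec_mx v i j).
  rewrite (_ : (fun v => _) = fun v : 'rV[R]_(r * r) => v 0 (mxvec_index i j)).
    exact: coord_continuous.
  by apply/funext => v; rewrite mxE.
have cont_mul k i j : continuous
    (fun v : 'rV[R]_(r * r) => vec_mx v k i * vec_mx v k j : R).
  by move=> v; apply: (cvgM (@cont_vec k i v) (@cont_vec k j v)).
have cont_scale a i j : continuous
    (fun v : 'rV[R]_(r * r) => a * vec_mx v i j : R).
  by move=> v; apply: (cvgM (cvg_cst a) (@cont_vec i j v)).
have cA : compact A.
  pose J := [set x : R | -1 <= x <= 1]%classic.
  have cJ : compact J by rewrite /J -set_itvcc; exact: segment_compact.
  pose B := [set v : 'rV[R]_(r * r) | forall i, J (v ord0 i)]%classic.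
  apply: (@subclosed_compact _ _ B).
  (* Closed: an intersection of level sets of the polynomials $\sum_k Q_{ki}Q_{kj}$. *)
  - have -> : A = (\bigcap_(ij : 'I_r * 'I_r) ((fun v : 'rV[R]_(r * r) =>
      \sum_k vec_mx v k ij.1 * vec_mx v k ij.2) @^-1`
        [set x | x = (ij.1 == ij.2)%:R]))%classic.
      apply/seteqP; split => v.
        move=> /= /matrixP Av [i j] _ /=; have := Av i j.
        rewrite !mxE => <-; apply: eq_bigr => k _; by rewrite !mxE.
      move=> /= Av; apply/matrixP => i j; have /= := Av (i, j) I.
      rewrite !mxE => <-; apply: eq_bigr => k _; by rewrite !mxE.
    apply: closed_bigI => -[i j] _ /=.
    apply: preimage_closed; last exact: closed_eq.
    move=> v _.
    apply: (continuous_big add_continuous) => k _; exact: cont_mul.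
  - by apply: (@rV_compact _ _ (fun=> J)) => i.
  (* Bounded: unit columns force every entry into $[-1,1]$. *)
  - move=> v /= /matrixP Av i.
    have [a [b ->]] : exists a b, v ord0 i = vec_mx v a b.
      case/mxvec_indexP: i => a b; exists a, b; by rewrite mxE.
    have := Av b b; rewrite !mxE eqxx => H.
    have : vec_mx v a b ^+ 2 <= 1.
      rewrite -[X in _ <= X]H (bigD1 a) //= !mxE -expr2 lerDl sumr_ge0 // => k _.
      by rewrite !mxE -expr2 sqr_ge0.
    rewrite /J /= -ler_norml -[X in X <= _ -> _]real_normK ?num_real //.
    by rewrite expr_le1 ?normr_ge0 // mxE.
have [] := @EVT_max_rV R _ (fun v => \tr (N *m vec_mx v)) A A0 cA.
  apply: continuous_subspaceT.
  apply: (continuous_big add_continuous) => i _.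
  have -> : (fun v : 'rV[R]_(r * r) => (N *m vec_mx v) i i) =
      fun v => \sum_j N i j * vec_mx v j i.
    by apply/funext => w; rewrite mxE.
  by apply: (continuous_big add_continuous) => j _; exact: cont_scale.
move=> v /set_mem vA vmax; exists (vec_mx v); first exact: vA.
move=> G Go; have := vmax (mxvec G); rewrite mxvecK; apply.
by rewrite inE /A /= mxvecK.
Qed.

(** * Inner product, norm, and positivity at a trace maximizer *)

Section Frobenius.
Variable R : rcfType.

Definition fdot p q (A B : 'M[R]_(p, q)) : R := \sum_i \sum_j A i j * B i j.
Definition fnorm p q (A : 'M[R]_(p, q)) : R := Num.sqrt (fdot A A).

Lemma fdotE p q (A B : 'M[R]_(p, q)) : fdot A B = \tr (A^T *m B).
Proof.
rewrite /fdot /mxtrace exchange_big; apply: eq_bigr => j _.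
by rewrite mxE; apply: eq_bigr => i _; rewrite mxE.
Qed.

Lemma fdotC p q (A B : 'M[R]_(p, q)) : fdot A B = fdot B A.
Proof. by apply: eq_bigr => i _; apply: eq_bigr => j _; rewrite mulrC. Qed.

Lemma fdotDr p q (A B C : 'M[R]_(p, q)) : fdot A (B + C) = fdot A B + fdot A C.
Proof. by rewrite !fdotE mulmxDr mxtraceD. Qed.

Lemma fdotZr p q a (A B : 'M[R]_(p, q)) : fdot A (a *: B) = a * fdot A B.
Proof. by rewrite !fdotE -scalemxAr mxtraceZ. Qed.

Lemma fdotNr p q (A B : 'M[R]_(p, q)) : fdot A (- B) = - fdot A B.
Proof. by rewrite -scaleN1r fdotZr mulN1r. Qed.

Lemma fdotDl p q (A B C : 'M[R]_(p, q)) : fdot (A + B) C = fdot A C + fdot B C.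
Proof. by rewrite !(fdotC _ C) fdotDr. Qed.

Lemma fdotZl p q a (A B : 'M[R]_(p, q)) : fdot (a *: A) B = a * fdot A B.
Proof. by rewrite !(fdotC _ B) fdotZr. Qed.

Lemma fdotNl p q (A B : 'M[R]_(p, q)) : fdot (- A) B = - fdot A B.
Proof. by rewrite !(fdotC _ B) fdotNr. Qed.

Lemma fdot0r p q (A : 'M[R]_(p, q)) : fdot A 0 = 0.
Proof. by rewrite fdotE mulmx0 mxtrace0. Qed.

Definition fdot_lin := (fdotDl, fdotDr, fdotNl, fdotNr, fdotZl, fdotZr).

Lemma fdotT p q (A B : 'M[R]_(p, q)) : fdot A^T B^T = fdot A B.
Proof.
rewrite /fdot exchange_big; apply: eq_bigr => i _.
by apply: eq_bigr => j _; rewrite !mxE.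
Qed.

Lemma fdot_mull p q s (A : 'M[R]_(p, q)) (B : 'M_(q, s)) C :
  fdot (A *m B) C = fdot B (A^T *m C).
Proof. by rewrite !fdotE trmx_mul mulmxA. Qed.

Lemma fdot_mulr p q s (A : 'M[R]_(p, q)) (B : 'M_(q, s)) C :
  fdot (A *m B) C = fdot A (C *m B^T).
Proof. by rewrite !fdotE trmx_mul mxtrace_mulC mulmxA mxtrace_mulC. Qed.

Lemma fdot_ge0 p q (A : 'M[R]_(p, q)) : 0 <= fdot A A.
Proof.
by apply: sumr_ge0 => i _; apply: sumr_ge0 => j _; rewrite -expr2 sqr_ge0.
Qed.

Lemma fdot_eq0 p q (A : 'M[R]_(p, q)) : fdot A A = 0 -> A = 0.
Proof.
move=> A0; apply/matrixP => i j; rewrite mxE.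
have ge0 k : 0 <= \sum_j A k j * A k j.
  by apply: sumr_ge0 => l _; rewrite -expr2 sqr_ge0.
have Ai0 : \sum_j A i j * A i j = 0.
  by apply: (psumr_eq0P _ A0) => // k _; exact: ge0.
apply/eqP; rewrite -sqrf_eq0 expr2; apply/eqP.
by apply: (psumr_eq0P _ Ai0) => // k _; rewrite -expr2 sqr_ge0.
Qed.

Lemma fnorm_ge0 p q (A : 'M[R]_(p, q)) : 0 <= fnorm A.
Proof. exact: sqrtr_ge0. Qed.

Lemma sqr_fnorm p q (A : 'M[R]_(p, q)) : fnorm A ^+ 2 = fdot A A.
Proof. by rewrite sqr_sqrtr ?fdot_ge0. Qed.

Lemma fnorm0 p q : fnorm (0 : 'M[R]_(p, q)) = 0.
Proof. by rewrite /fnorm fdot0r sqrtr0. Qed.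

Lemma fnormN p q (A : 'M[R]_(p, q)) : fnorm (- A) = fnorm A.
Proof. by rewrite /fnorm !fdot_lin opprK. Qed.

Lemma fnormZ p q a (A : 'M[R]_(p, q)) : fnorm (a *: A) = `|a| * fnorm A.
Proof. by rewrite /fnorm !fdot_lin mulrA -expr2 sqrtrM ?sqr_ge0 // sqrtr_sqr. Qed.

Lemma fnormBC p q (A B : 'M[R]_(p, q)) : fnorm (A - B) = fnorm (B - A).
Proof. by rewrite -fnormN opprB. Qed.

(** Cauchy-Schwarz: $|\langle B,B\rangle A-\langle A,B\rangle B|^2$ equals $\langle
    B,B\rangle(\langle A,A\rangle\langle B,B\rangle-\langle A,B\rangle^2)$. *)
Lemma fdot_le p q (A B : 'M[R]_(p, q)) : fdot A B <= fnorm A * fnorm B.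
Proof.
have [B0|B0] := eqVneq (fdot B B) 0.
  by rewrite (fdot_eq0 B0) fdot0r fnorm0 mulr0.
have Bp : 0 < fdot B B by rewrite lt_def B0 fdot_ge0.
have := fdot_ge0 (fdot B B *: A - fdot A B *: B).
rewrite !fdot_lin (fdotC B A) => H.
have {}H : fdot A B ^+ 2 <= fdot A A * fdot B B.
  rewrite -(ler_pM2l Bp) -subr_ge0; apply: le_trans H _.
  by rewrite le_eqVlt; apply/orP; left; apply/eqP; ring.
apply: le_trans (ler_norm _) _.
rewrite -(@ler_pXn2r _ 2) ?nnegrE ?mulr_ge0 ?fnorm_ge0 //.
by rewrite exprMn !sqr_fnorm real_normK ?num_real.
Qed.

Lemma fnormD p q (A B : 'M[R]_(p, q)) : fnorm (A + B) <= fnorm A + fnorm B.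
Proof.
rewrite -(@ler_pXn2r _ 2) ?nnegrE ?addr_ge0 ?fnorm_ge0 //.
rewrite sqrrD !sqr_fnorm !fdot_lin (fdotC B A).
have := fdot_le A B; lra.
Qed.

Lemma fnorm_triangle p q (A B C : 'M[R]_(p, q)) :
  fnorm (A - C) <= fnorm (A - B) + fnorm (B - C).
Proof. by apply: le_trans (fnormD _ _); rewrite addrA subrK. Qed.

Lemma fdot_orth p q s (V : 'M[R]_(p, q)) (A B : 'M_(q, s)) :
  V^T *m V = 1%:M -> fdot (V *m A) (V *m B) = fdot A B.
Proof. by move=> Vo; rewrite fdot_mull mulmxA Vo mul1mx. Qed.

Lemma fdot_sum_col p q (A B : 'M[R]_(p, q)) :
  fdot A B = \sum_j fdot (col j A) (col j B).
Proof.
rewrite /fdot exchange_big; apply: eq_bigr => j _; apply: eq_bigr => i _.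
by rewrite big_ord1 !mxE.
Qed.

Definition psdmx n (S : 'M[R]_n) :=
  S^T = S /\ forall v : 'cV[R]_n, 0 <= fdot v (S *m v).

(* Testing [G] on one Householder reflection gives positivity, on a product of
   two reflections (a plane rotation) gives symmetry. *)
Lemma orthogonal_trace_max_psd r (S : 'M[R]_r) :
  (forall G, G^T *m G = 1%:M -> \tr (S *m G) <= \tr S) -> psdmx S.
Proof.
move=> Smax.
pose refl (u : 'cV[R]_r) := 1%:M - (2 / fdot u u) *: (u *m u^T).
have uu (u : 'cV[R]_r) : u^T *m u = (fdot u u)%:M.
  by rewrite fdotE [LHS]mx11_scalar /mxtrace big_ord1.
have reflT u : (refl u)^T = refl u.
  by rewrite /refl linearB /= linearZ /= trmx_mul trmxK trmx1.
have reflK u : fdot u u != 0 -> refl u *m refl u = 1%:M.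
  move=> u0; rewrite /refl mulmxBl mul1mx mulmxBr mulmx1.
  rewrite -scalemxAl -scalemxAr -mulmxA (mulmxA u^T) uu mul_scalar_mx.
  rewrite -scalemxAr !scalerA -scalerBl -addrA -opprD -scalerDl.
  have -> : 2 / fdot u u + (2 / fdot u u - 2 / fdot u u * (2 / fdot u u * fdot u u)) = 0.
    by field.
  by rewrite scale0r subr0.
have reflM u v : fdot u u != 0 -> fdot v v != 0 ->
    (refl u *m refl v)^T *m (refl u *m refl v) = 1%:M.
  move=> u0 v0; rewrite trmx_mul !reflT -mulmxA (mulmxA (refl u)) reflK //.
  by rewrite mul1mx reflK.
have trS (u v : 'cV[R]_r) : \tr (S *m (u *m v^T)) = fdot v (S *m u).
  by rewrite mulmxA mxtrace_mulC fdotE.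
have pos (u : 'cV[R]_r) : 0 <= fdot u (S *m u).
  have [u0|u0] := eqVneq (fdot u u) 0.
    by rewrite (fdot_eq0 u0) mulmx0 fdot0r.
  have := Smax (refl u); rewrite reflT reflK // => /(_ erefl).
  rewrite /refl mulmxBr mulmx1 raddfB /= -scalemxAr mxtraceZ trS => H.
  have {}H : 0 <= 2 / fdot u u * fdot u (S *m u) by lra.
  by rewrite pmulr_rge0 // divr_gt0 // lt_def u0 fdot_ge0 in H.
split => //.
have fd i j : fdot (delta_mx i 0 : 'cV[R]_r) (S *m delta_mx j 0) = S i j.
  rewrite -colE /fdot (bigD1 i) //= big_ord1 !mxE !eqxx mul1r big1 ?addr0 //.
  by move=> k ki; rewrite big_ord1 !mxE (negPf ki) mul0r.
have fd1 i j : fdot (delta_mx i 0 : 'cV[R]_r) (delta_mx j 0) = (i == j)%:R.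
  rewrite /fdot (bigD1 i) //= big_ord1 !mxE !eqxx andbT mul1r big1 ?addr0 ?andbT //.
  by move=> k ki; rewrite big_ord1 !mxE (negPf ki) mul0r.
apply/matrixP => i j; rewrite mxE.
have [->//|ij] := eqVneq i j.
(* The reflections along $e_i$ and $e_i+te_j$ compose to a rotation of the $(i,j)$ plane; clearing
   the denominator $1+t^2$ leaves a linear against a quadratic term in $t$. *)
have skew t : t * (S j i - S i j) <= t ^+ 2 * (S i i + S j j).
  pose u : 'cV[R]_r := delta_mx i 0.
  pose v : 'cV[R]_r := delta_mx i 0 + t *: delta_mx j 0.
  have uE : fdot u u = 1 by rewrite fd1 eqxx.
  have vE : fdot v v = 1 + t ^+ 2.
    by rewrite !fdot_lin !fd1 !eqxx (negPf ij) (eq_sym j) (negPf ij) /=; ring.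
  have v0 : 0 < 1 + t ^+ 2 by rewrite ltr_pwDl ?sqr_ge0.
  have uv : fdot u v = 1 by rewrite !fdot_lin !fd1 !eqxx (negPf ij) /=; ring.
  have := Smax _ (reflM u v _ _); rewrite uE vE oner_eq0 gt_eqF // => /(_ isT isT).
  have -> : refl u *m refl v = 1%:M - (2 / fdot u u) *: (u *m u^T)
      - (2 / fdot v v) *: (v *m v^T)
      + (2 / fdot u u * (2 / fdot v v)) *: (u *m v^T).
    rewrite /refl mulmxBl mul1mx mulmxBr mulmx1 -scalemxAl -scalemxAr scalerA.
    rewrite -mulmxA (mulmxA u^T) [u^T *m v]mx11_scalar.
    have -> : (u^T *m v) 0 0 = 1 by rewrite -[RHS]uv fdotE /mxtrace big_ord1.
    by rewrite mul1mx opprB addrA addrAC (addrAC 1%:M).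
  rewrite mulmxDr !mulmxBr mulmx1 -!scalemxAr !mxtraceD !raddfN /= !mxtraceZ.
  rewrite !trS.
  rewrite uE vE /u /v mulmxDr -scalemxAr !fdot_lin !fd => H.
  set w := 1 + t ^+ 2 in v0 H.
  rewrite -(ler_pM2l v0) -subr_ge0 in H.
  rewrite -subr_ge0 -(pmulr_rge0 _ (ltr0Sn R 1)); apply: le_trans H _.
  rewrite le_eqVlt; apply/orP; left; apply/eqP; rewrite /w; field.
  by rewrite -/w gt_eqF.
(* With $d=S_{ji}-S_{ij}$ and $s=S_{ii}+S_{jj}$, the choice $t=d/(s+1)$ gives $d^2(s+1)\le d^2s$, so
   $d=0$; the added 1 keeps the denominator positive. *)
have := skew ((S j i - S i j) / (S i i + S j j + 1)).
set d := S j i - S i j; set s := S i i + S j j.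
have s0 : 0 <= s by rewrite /s -(fd i) -(fd j) addr_ge0.
have s1 : 0 < s + 1 by rewrite ltr_wpDl.
rewrite -(ler_pM2l s1) -(ler_pM2l s1) => H.
have {}H : d ^+ 2 * (s + 1) <= d ^+ 2 * s.
  by move: H; congr (_ <= _); field; rewrite gt_eqF.
have : d ^+ 2 = 0 by apply/eqP; rewrite eq_le sqr_ge0 andbT; lra.
by move/eqP; rewrite sqrf_eq0 subr_eq0 => /eqP.
Qed.
End Frobenius.

(** * Spectral decompositions *)

Section Spectral.
Variable R : rcfType.

Lemma col_mulmx p q k (A : 'M[R]_(p, q)) (B : 'M_(q, k)) j :
  col j (A *m B) = A *m col j B.
Proof. by rewrite !colE mulmxA. Qed.

Lemma fdot_form_ge p q k (s : R) (B : 'M[R]_(p, q)) (X : 'M_(q, k)) :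
  (forall x : 'cV_q, s * fdot x x <= fdot (B *m x) (B *m x)) ->
  s * fdot X X <= fdot (B *m X) (B *m X).
Proof.
move=> Bs; rewrite !(fdot_sum_col _ X) (fdot_sum_col (B *m X)) mulr_sumr.
by apply: ler_sum => j _; rewrite !col_mulmx.
Qed.

(** [V] is already aligned with [U], and [s] bounds $V^TV$ from below. The squared norm of
    $AB^T+BA^T$ is $2|BA^T|^2$ plus twice a nonnegative cross term. *)
Lemma procrustes_le n r (U V : 'M[R]_(n, r)) s :
  psdmx (U^T *m V) ->
  (forall x : 'cV_r, s * fdot x x <= fdot (V *m x) (V *m x)) ->
  s * fdot (U - V) (U - V)
    <= 2 * fdot (U *m U^T - V *m V^T) (U *m U^T - V *m V^T).
Proof.
move=> [UVsym UVpos] Vs; set A := U - V; pose B := U + V.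
have VU : V^T *m U = U^T *m V by rewrite -UVsym trmx_mul trmxK.
(* $B^TB=U^TU+2U^TV+V^TV\ge V^TV$, the first two terms being positive semidefinite. *)
have Bs : s * fdot A^T A^T <= fdot (B *m A^T) (B *m A^T).
  apply: fdot_form_ge => x; apply: le_trans (Vs x) _.
  rewrite /B mulmxDl !fdot_lin (fdotC (V *m x) (U *m x)).
  have -> : fdot (U *m x) (V *m x) = fdot x (U^T *m V *m x).
    by rewrite fdot_mull mulmxA.
  have := UVpos x; have := fdot_ge0 (U *m x); lra.
have sum2 : A *m B^T + B *m A^T = 2 *: (U *m U^T - V *m V^T).
  rewrite /A /B [(U + V)^T]linearD [(U - V)^T]linearB /=.
  rewrite mulmxBl mulmxDl !mulmxBr !mulmxDr.
  move: (U *m U^T) (U *m V^T) (V *m U^T) (V *m V^T) => a b c d.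
  by apply/matrixP => i j; rewrite !mxE; ring.
have cross : 0 <= fdot (A *m B^T) (B *m A^T).
  (* Symmetry of $U^TV$ cancels the mixed products, so $B^TA$ is symmetric and the cross term is
     $|B^TA|^2$. *)
  have BA : B^T *m A = U^T *m U - V^T *m V.
    rewrite /A /B [(U + V)^T]linearD /= mulmxBr !mulmxDl VU.
    by rewrite opprD !addrA addrK.
  have AB : A^T *m B = B^T *m A.
    by rewrite -[A^T *m B]trmxK trmx_mul trmxK BA linearB /= !trmx_mul !trmxK.
  by rewrite fdot_mulr trmxK fdotC -mulmxA fdot_mull AB fdot_ge0.
have <- : fdot A^T A^T = fdot A A by rewrite fdotT.
apply: le_trans Bs _.
have := congr1 (fun X => fdot X X) sum2; rewrite !fdot_lin.
have -> : fdot (A *m B^T) (A *m B^T) = fdot (B *m A^T) (B *m A^T).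
  by rewrite -fdotT trmx_mul trmxK.
rewrite (fdotC (B *m A^T) (A *m B^T)); move: cross; lra.
Qed.

Definition spect n (V : 'M[R]_n) (l : 'I_n -> R) :=
  V *m diag_mx (\row_i l i) *m V^T.

Definition trunc n (r : nat) (l : 'I_n -> R) (i : 'I_n) : R :=
  if (i < r)%N then l i else 0.

Lemma tr_spect n (V : 'M[R]_n) l : (spect V l)^T = spect V l.
Proof. by rewrite /spect !trmx_mul trmxK tr_diag_mx mulmxA. Qed.

Lemma mul_spect n (V : 'M[R]_n) l l' : V^T *m V = 1%:M ->
  spect V l *m spect V l' = spect V (fun i => l i * l' i).
Proof.
move=> Vo; rewrite /spect !mulmxA -(mulmxA _ V^T) Vo mulmx1 -(mulmxA V).
congr (_ *m _ *m _); apply/matrixP => i j.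
by rewrite mul_diag_mx !mxE mulrnAr.
Qed.

Lemma eq_spect n (V : 'M[R]_n) l l' : l =1 l' -> spect V l = spect V l'.
Proof. by move=> ll'; congr (_ *m diag_mx _ *m _); apply/rowP => i; rewrite !mxE. Qed.

Lemma fdot_spect n (X V : 'M[R]_n) l :
  fdot X (spect V l) = \sum_i l i * fdot (col i V) (X *m col i V).
Proof.
rewrite /spect (fdotC X) fdot_mulr trmxK fdotC fdot_sum_col.
apply: eq_bigr => i _; rewrite col_mulmx fdotC -fdotZl; congr fdot.
by apply/colP => j; rewrite mxE mul_mx_diag !mxE mulrC.
Qed.

(** With $O=V^TV'$ the difference is $V(\mathrm{diag}(l)O-O\,\mathrm{diag}(l'))V'^T$, and the outer
    factors preserve the norm. Both Eckart-Young and the uniqueness of eigenvalues rest on this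
    formula. *)
Lemma fdot_spectB n (V V' : 'M[R]_n) l l' :
    V^T *m V = 1%:M -> V'^T *m V' = 1%:M ->
  fdot (spect V l - spect V' l') (spect V l - spect V' l') =
  \sum_i \sum_k (l i - l' k) ^+ 2 * (V^T *m V') i k ^+ 2.
Proof.
move=> Vo Vo'; have Vo1 := mulmx1C Vo; have Vo1' := mulmx1C Vo'.
have -> : spect V l - spect V' l' =
    V *m (diag_mx (\row_i l i) *m (V^T *m V')
          - (V^T *m V') *m diag_mx (\row_i l' i)) *m V'^T.
  rewrite mulmxBr mulmxBl /spect !mulmxA Vo1 mul1mx; congr (_ - _).
  by rewrite -!mulmxA Vo1' mulmx1.
rewrite fdot_mulr trmxK -(mulmxA _ V'^T) Vo' mulmx1 fdot_orth //.
apply: eq_bigr => i _; apply: eq_bigr => k _.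
by rewrite mxE mul_diag_mx mul_mx_diag !mxE; set w := \sum_j _; ring.
Qed.

Lemma orth_row_sum n (O : 'M[R]_n) i : O^T *m O = 1%:M -> \sum_k O i k ^+ 2 = 1.
Proof.
move=> /mulmx1C /matrixP/(_ i i); rewrite !mxE eqxx mulr1n => <-.
by apply: eq_bigr => k _; rewrite mxE expr2.
Qed.

Lemma orth_col_sum n (O : 'M[R]_n) k : O^T *m O = 1%:M -> \sum_i O i k ^+ 2 = 1.
Proof.
move=> /matrixP/(_ k k); rewrite !mxE eqxx mulr1n => <-.
by apply: eq_bigr => i _; rewrite mxE expr2.
Qed.

Lemma orth_mulT n (V V' : 'M[R]_n) : V^T *m V = 1%:M -> V'^T *m V' = 1%:M ->
  (V^T *m V')^T *m (V^T *m V') = 1%:M.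
Proof.
by move=> /mulmx1C Vo Vo'; rewrite trmx_mul trmxK mulmxA -(mulmxA _ V) Vo mulmx1.
Qed.

Lemma fdot_spect_trunc n r (V : 'M[R]_n) l : V^T *m V = 1%:M ->
  fdot (spect V l - spect V (trunc r l)) (spect V l - spect V (trunc r l)) =
  \sum_(i < n | (r <= i)%N) l i ^+ 2.
Proof.
move=> Vo; rewrite fdot_spectB // Vo [RHS]big_mkcond; apply: eq_bigr => i _.
rewrite (bigD1 i) //= big1 => [|k ki]; rewrite !mxE; last first.
  by rewrite eq_sym (negPf ki) expr0n mulr0.
rewrite eqxx expr1n mulr1 addr0 /trunc ltnNge.
by case: leqP => _; rewrite ?subr0 // subrr expr0n.
Qed.

(* In the eigenbases the error is [sum_ik (l i - l' k)^2 O_ik^2] with [O_ik^2]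
   doubly stochastic; dropping the columns [k < r] leaves weights [q i] in [0, 1]
   of total mass [n - r] on the decreasing sequence [l i ^+ 2]. *)
Lemma eckart_young n r (V V' : 'M[R]_n) (l l' : 'I_n -> R) (i0 : 'I_n) :
    V^T *m V = 1%:M -> V'^T *m V' = 1%:M -> (i0 = r.-1 :> nat) -> (0 < r)%N ->
    (forall i, 0 <= l i) -> (forall i j : 'I_n, (i <= j)%N -> l j <= l i) ->
  fdot (spect V l - spect V (trunc r l)) (spect V l - spect V (trunc r l)) <=
  fdot (spect V l - spect V' (trunc r l')) (spect V l - spect V' (trunc r l')).
Proof.
move=> Vo Vo' i0E r0 l0 ldec; rewrite fdot_spect_trunc // fdot_spectB //.
set O := V^T *m V'; have Oo : O^T *m O = 1%:M by apply: orth_mulT.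
pose q i := \sum_(k < n | (r <= k)%N) O i k ^+ 2.
apply: (@le_trans _ _ (\sum_i l i ^+ 2 * q i)); last first.
  apply: ler_sum => i _; rewrite /q mulr_sumr.
  rewrite [leRHS](bigID (fun k : 'I_n => r <= k)%N) /=.
  rewrite -[leLHS]addr0; apply: lerD; last first.
    by apply: sumr_ge0 => k _; rewrite mulr_ge0 ?sqr_ge0.
  by apply: ler_sum => k rk; rewrite /trunc ltnNge rk subr0.
have q0 i : 0 <= q i by apply: sumr_ge0 => k _; rewrite sqr_ge0.
have q1 i : q i <= 1.
  rewrite -(orth_row_sum i Oo) [leRHS](bigID (fun k : 'I_n => r <= k)%N) /= lerDl.
  by apply: sumr_ge0 => k _; rewrite sqr_ge0.
have qsum : \sum_i q i = \sum_(i < n | (r <= i)%N) 1.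
  rewrite /q exchange_big; apply: eq_bigr => k _; exact: orth_col_sum.
(* Rearrangement around the threshold $c$: $l_i^2-c$ and $q_i-[r\le i]$ never have opposite signs,
   and the latter sums to zero. *)
pose c := l i0 ^+ 2.
have : \sum_(i < n) c * (q i - (if (r <= i)%N then 1 else 0)) <=
       \sum_(i < n) l i ^+ 2 * (q i - (if (r <= i)%N then 1 else 0)).
  apply: ler_sum => i _; rewrite -subr_ge0 -mulrBl.
  have [ri|ir] := leqP r i.
    rewrite mulr_le0 // ?subr_le0 //.
    by rewrite ler_pXn2r ?nnegrE // ldec // i0E; apply: leq_trans ri; rewrite leq_pred.
  rewrite subr0 mulr_ge0 // subr_ge0 ler_pXn2r ?nnegrE // ldec // i0E.
  by rewrite -ltnS prednK.
rewrite -mulr_sumr sumrB qsum -big_mkcond subrr mulr0.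
under eq_bigr do rewrite mulrBr.
rewrite sumrB subr_ge0 => /(le_trans _); apply.
rewrite big_mkcond; apply: ler_sum => i _.
by case: ifP => _; rewrite ?mulr1 ?mulr0.
Qed.

(* If [l j < l' j] then [V^T V'] vanishes on the block [i >= j, k <= j], so its
   [n - j] unit rows would have all their mass in [n - j - 1] unit columns. *)
Lemma spect_inj_le n (V V' : 'M[R]_n) (l l' : 'I_n -> R) :
    V^T *m V = 1%:M -> V'^T *m V' = 1%:M ->
    (forall i j : 'I_n, (i <= j)%N -> l j <= l i) ->
    (forall i j : 'I_n, (i <= j)%N -> l' j <= l' i) ->
  spect V l = spect V' l' -> forall j, l' j <= l j.
Proof.
move=> Vo Vo' ldec ldec' VV' j; rewrite leNgt; apply/negP => lj.
set O := V^T *m V'; have Oo : O^T *m O = 1%:M by apply: orth_mulT.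
have O0 (i k : 'I_n) : (j <= i)%N -> (k <= j)%N -> O i k = 0.
  move=> ji kj; have := fdot_spectB l l' Vo Vo'.
  rewrite VV' subrr fdot0r => /esym sum0.
  have pos i' k' : 0 <= (l i' - l' k') ^+ 2 * O i' k' ^+ 2.
    by rewrite mulr_ge0 ?sqr_ge0.
  have sumi0 : \sum_k (l i - l' k) ^+ 2 * O i k ^+ 2 = 0.
    by apply: (psumr_eq0P _ sum0) => // i' _; apply: sumr_ge0.
  have /eqP := psumr_eq0P (fun k' _ => pos i k') sumi0 (i := k) isT.
  rewrite mulf_eq0 !sqrf_eq0 subr_eq0 => /orP[/eqP lik|/eqP //].
  have := ldec _ _ ji; have := ldec' _ _ kj; rewrite lik => a b.
  by have := le_lt_trans (le_trans a b) lj; rewrite ltxx.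
have : \sum_(i < n | (j <= i)%N) (1 : R) <= \sum_(k < n | (j < k)%N) 1.
  have -> : \sum_(i < n | (j <= i)%N) (1 : R) =
      \sum_(k < n | (j < k)%N) \sum_(i < n | (j <= i)%N) O i k ^+ 2.
    rewrite exchange_big /=; apply: eq_bigr => i ji.
    rewrite -(orth_row_sum i Oo) (bigID (fun k : 'I_n => j < k)%N) /=.
    rewrite [X in _ + X]big1 ?addr0 // => k; rewrite -leqNgt => kj.
    by rewrite O0 // expr0n.
  apply: ler_sum => k _.
  rewrite -(orth_col_sum k Oo) [leRHS](bigID (fun i : 'I_n => j <= i)%N) /= lerDl.
  by apply: sumr_ge0 => i _; rewrite sqr_ge0.
(* The left sum has one term more, $i=j$, which would give $1\le0$. *)
rewrite (bigD1 j) //= (eq_bigl (fun k : 'I_n => j < k)%N).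
  by rewrite gerDr ler10.
by move=> i; rewrite ltn_neqAle andbC eq_sym.
Qed.

(** The one-sided comparison applies both ways round. Through it [eigvals], a choice by [epsilon],
    equals any sorted spectrum at hand. *)
Lemma spect_inj n (V V' : 'M[R]_n) (l l' : 'I_n -> R) :
    V^T *m V = 1%:M -> V'^T *m V' = 1%:M ->
    (forall i j : 'I_n, (i <= j)%N -> l j <= l i) ->
    (forall i j : 'I_n, (i <= j)%N -> l' j <= l' i) ->
  spect V l = spect V' l' -> l =1 l'.
Proof.
move=> Vo Vo' ldec ldec' VV' j; apply/eqP; rewrite eq_le.
by apply/andP; split; [apply: (spect_inj_le Vo' Vo)|apply: (spect_inj_le Vo Vo')].
Qed.

Lemma spect_form n (V : 'M[R]_n) l (x : 'cV_n) :
  fdot x (spect V l *m x) = \sum_i l i * (V^T *m x) i 0 ^+ 2.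
Proof.
rewrite /spect -!mulmxA fdotC fdot_mull; move: (V^T *m x) => y.
by apply: eq_bigr => i _; rewrite big_ord1 mul_diag_mx !mxE -mulrA expr2.
Qed.

Lemma spect_ge n (V : 'M[R]_n) l s (x : 'cV_n) :
    V^T *m V = 1%:M -> (forall i, s <= l i) ->
  s * fdot x x <= fdot x (spect V l *m x).
Proof.
move=> /mulmx1C Vo ls; rewrite spect_form.
have -> : fdot x x = fdot (V^T *m x) (V^T *m x) by rewrite fdot_orth ?trmxK.
rewrite /fdot mulr_sumr; apply: ler_sum => i _.
by rewrite big_ord1 -expr2 ler_wpM2r ?sqr_ge0.
Qed.

End Spectral.

(** * Rank, Gram matrices and the semidefinite cone *)

Section Gram.
Variable R : rcfType.

(** The diagonal factor absorbs [pid_mx r]. *)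
Lemma rank_spect_le n r (V : 'M[R]_n) l :
  (r <= n)%N -> (forall i : 'I_n, (r <= i)%N -> l i = 0) -> (\rank (spect V l) <= r)%N.
Proof.
move=> rn l0; rewrite /spect.
have -> : diag_mx (\row_i l i) = diag_mx (\row_i l i) *m pid_mx r.
  apply/matrixP => i j; rewrite mul_diag_mx !mxE.
  have [<-|ij] := eqVneq i j.
    by rewrite !eqxx /= mulr1n; case: ltnP => ri; rewrite ?mulr1 // mulr0 l0.
  by rewrite -[i == j :> nat]/(i == j) (negPf ij) mulr0.
apply: leq_trans (mxrankM_maxl _ _) _; rewrite mulmxA.
by apply: leq_trans (mxrankM_maxr _ _) _; rewrite rank_pid_mx.
Qed.

(** Were entry $r-1$ zero, all later ones would vanish and the rank would be below $r$. Positivity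
    here later allows division by $\sigma_r$. *)
Lemma rank_spect_pos n r (V : 'M[R]_n) l : (0 < r <= \rank (spect V l))%N ->
    (forall i, 0 <= l i) -> (forall i j : 'I_n, (i <= j)%N -> l j <= l i) ->
  exists2 i0 : 'I_n, i0 = r.-1 :> nat & 0 < l i0.
Proof.
case/andP=> r0 rV l0 ldec.
have rn : (r.-1 < n)%N by rewrite prednK // (leq_trans rV) // rank_leq_row.
exists (Ordinal rn) => //; rewrite lt_def l0 andbT; apply/negP => /eqP li0.
have : (\rank (spect V l) <= r.-1)%N.
  apply: rank_spect_le => [|i ri]; first exact: ltnW.
  by apply/eqP; rewrite eq_le l0 andbT -li0 ldec.
by move/(leq_trans rV); rewrite -ltnS prednK // ltnn.
Qed.

(** $UU^T$ and $U^TU$ share their nonzero eigenvalues. The rows of $Y=V^TU$ are pairwise orthogonal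
    with squared lengths [trunc r l]; the first [r] of them, normalized, are the columns of [Q]. *)
Lemma gram_spect n r (rn : (r <= n)%N) (V : 'M[R]_n) (l : 'I_n -> R) (U : 'M_(n, r)) :
    V^T *m V = 1%:M -> (forall i : 'I_n, (i < r)%N -> 0 < l i) ->
    U *m U^T = spect V (trunc r l) ->
  exists2 Q : 'M_r, Q^T *m Q = 1%:M & U^T *m U = spect Q (l \o widen_ord rn).
Proof.
move=> Vo lpos UU; pose Y := V^T *m U.
have YY i j : \sum_k Y i k * Y j k = trunc r l i *+ (i == j).
  have /matrixP/(_ i j) : Y *m Y^T = diag_mx (\row_i trunc r l i).
    rewrite /Y trmx_mul trmxK mulmxA -(mulmxA _ U) UU /spect !mulmxA Vo mul1mx.
    by rewrite -mulmxA Vo mulmx1.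
  by rewrite !mxE => <-; apply: eq_bigr => k _; rewrite !mxE.
have Y0 (i : 'I_n) k : (r <= i)%N -> Y i k = 0.
  move=> ri; have := YY i i; rewrite eqxx mulr1n /trunc ltnNge ri /= => sum0.
  apply/eqP; rewrite -sqrf_eq0 expr2; apply/eqP.
  by apply: (psumr_eq0P _ sum0) => // k' _; rewrite -expr2 sqr_ge0.
have UY : U^T *m U = Y^T *m Y.
  by rewrite /Y trmx_mul trmxK mulmxA -(mulmxA _ V) (mulmx1C Vo) mulmx1.
clearbody Y; rewrite {}UY; pose w := widen_ord rn.
have lw j : 0 < l (w j) by apply: lpos; rewrite /= ltn_ord.
pose Q := \matrix_(k, j) (Y (w j) k / Num.sqrt (l (w j))).
exists Q.
  apply/matrixP => i j; rewrite !mxE.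
  have -> : \sum_k Q^T i k * Q k j =
      (\sum_k Y (w i) k * Y (w j) k) / (Num.sqrt (l (w i)) * Num.sqrt (l (w j))).
    by rewrite mulr_suml; apply: eq_bigr => k _; rewrite !mxE invfM mulrACA.
  rewrite YY -[w i == w j]/(i == j).
  case: eqVneq => [<-|_]; last by rewrite mulr0n mul0r.
  by rewrite !mulr1n -expr2 sqr_sqrtr ?(ltW (lw _)) // /trunc /= ltn_ord divff // gt_eqF.
apply/matrixP => i j; rewrite /spect mul_mx_diag !mxE.
rewrite (bigID (fun k : 'I_n => k < r)%N) /= [X in _ + X]big1 ?addr0; last first.
  by move=> k; rewrite -leqNgt => rk; rewrite !mxE Y0 // mul0r.
rewrite (big_ord_narrow rn) /=; apply: eq_bigr => k _; rewrite !mxE.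
have : 0 < Num.sqrt (l (w k)) by rewrite sqrtr_gt0.
have : l (w k) = Num.sqrt (l (w k)) ^+ 2 by rewrite sqr_sqrtr // ltW.
rewrite /w; move: (Num.sqrt _) => z -> z0; field.
by rewrite gt_eqF.
Qed.

Lemma spect_psd n (V : 'M[R]_n) l : (forall i, 0 <= l i) -> psdmx (spect V l).
Proof.
move=> l0; split; first exact: tr_spect.
move=> x; rewrite spect_form sumr_ge0 // => i _.
by rewrite mulr_ge0 ?sqr_ge0.
Qed.

Lemma psd_spect_ge0 n (V : 'M[R]_n) l : V^T *m V = 1%:M -> psdmx (spect V l) ->
  forall i, 0 <= l i.
Proof.
move=> Vo [_ pos] i; have := pos (col i V).
rewrite spect_form -col_mulmx Vo (bigD1 i) //= big1 => [|k ki].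
  by rewrite !mxE eqxx expr1n mulr1 addr0.
by rewrite !mxE (negPf ki) expr0n mulr0.
Qed.

Lemma psdmxD n (X Y : 'M[R]_n) : psdmx X -> psdmx Y -> psdmx (X + Y).
Proof.
move=> [Xs Xp] [Ys Yp]; split; first by rewrite linearD /= Xs Ys.
by move=> v; rewrite mulmxDl fdotDr addr_ge0.
Qed.

Lemma psdmxZ n a (X : 'M[R]_n) : 0 <= a -> psdmx X -> psdmx (a *: X).
Proof.
move=> a0 [Xs Xp]; split; first by rewrite linearZ /= Xs.
by move=> v; rewrite -scalemxAl fdotZr mulr_ge0.
Qed.

Lemma psdmx0 n : psdmx (0 : 'M[R]_n).
Proof. by split=> [|v]; rewrite ?trmx0 // mul0mx fdot0r. Qed.

End Gram.

(** * The initialization *)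

Section Initialization.
Variables (R : rcfType) (n : nat) (F : 'M[R]_n -> R) (G : 'M[R]_n -> 'M[R]_n) (M m : R).
Hypothesis smooth : forall X Y, psdmx X -> psdmx Y ->
  fnorm (G X - G Y) <= M * fnorm (X - Y).
Hypothesis convex : forall X Y, psdmx X -> psdmx Y ->
  F X + fdot (G X) (Y - X) + m / 2 * fdot (Y - X) (Y - X) <= F Y.
Hypothesis m0 : 0 < m.
Variable Xs : 'M[R]_n.
Hypothesis Xs_psd : psdmx Xs.
Hypothesis Xs_min : forall Y, psdmx Y -> F Xs <= F Y.

(** Sum of the strong convexity inequalities at [X] and at [Y]. *)
Lemma gradient_monotone X Y : psdmx X -> psdmx Y ->
  m * fdot (Y - X) (Y - X) <= fdot (G Y - G X) (Y - X).
Proof.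
move=> Xp Yp; have := convex Xp Yp; have := convex Yp Xp.
rewrite -(opprB Y X) !fdot_lin opprK; lra.
Qed.

(* Strong convexity at [Xs + t H] and minimality give [<G (Xs + t H), H> >= 0];
   smoothness lets [t] tend to [0]. *)
Lemma gradient_min_ge0 (H : 'M_n) : (forall t : R, 0 < t <= 1 -> psdmx (Xs + t *: H)) ->
  0 <= fdot (G Xs) H.
Proof.
move=> Hp; rewrite leNgt; apply/negP => neg.
set a := - fdot (G Xs) H; have a0 : 0 < a by rewrite oppr_gt0.
have key t : 0 < t <= 1 -> a <= t * (M * fdot H H).
  move=> /[dup] t01 /andP[t0 t1]; have tp := Hp t t01.
  have diff : Xs + t *: H - Xs = t *: H by rewrite addrAC subrr add0r.
  have := convex tp Xs_psd; rewrite -opprB diff !fdot_lin opprK.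
  move=> /le_trans/(_ (Xs_min tp)).
  rewrite -addrA gerDl => le0.
  have GH : 0 <= fdot (G (Xs + t *: H)) H.
    rewrite -(pmulr_rge0 _ t0); apply: le_trans (_ : m / 2 * (t * (t * fdot H H)) <= _).
      by rewrite !mulr_ge0 ?fdot_ge0 ?invr_ge0 ?(ltW m0) ?(ltW t0).
    by move: le0; lra.
  have := fdot_le (G (Xs + t *: H) - G Xs) H; rewrite !fdot_lin => cs.
  have := smooth tp Xs_psd; rewrite diff fnormZ gtr0_norm // => sm.
  rewrite -sqr_fnorm; have := ler_wpM2r (fnorm_ge0 H) sm; rewrite /a; lra.
(* At $t=1$ the estimate gives $a\le c$, so $t=a/(2c)$ lies in $(0,1]$; there it reads $a\le a/2$,
   against $a>0$. *)
have c1 := key 1; rewrite ltr01 lexx mul1r in c1; have {}c1 := c1 isT.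
set c := M * fdot H H in key c1.
have c0 : 0 < c by apply: lt_le_trans c1.
have := key (a / (2 * c)).
have -> : a / (2 * c) * c = a / 2 by field; rewrite gt_eqF.
have -> : 0 < a / (2 * c) <= 1.
  apply/andP; split; first by rewrite divr_gt0 // mulr_gt0.
  by rewrite ler_pdivrMr; [lra|rewrite mulr_gt0].
move=> /(_ isT); lra.
Qed.

Variables (V : 'M[R]_n) (l : 'I_n -> R) (E : 'M[R]_n).
Hypothesis V_orth : V^T *m V = 1%:M.
Hypothesis grad0 : - G 0 = spect V l.
Hypothesis E_psd : psdmx E.
Hypothesis E_unit : fdot E E = 1.

(** [P] is the projection of $-\nabla f(0)$ onto the cone and $1/D$ its scaling in $X^0$; [E] stands
    for $e_1e_1^T$. *)
Let pospart i := if 0 < l i then l i else 0.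
Let P := spect V pospart.
Let D := fnorm (G 0 - G E).

Let pospart_ge0 i : 0 <= pospart i.
Proof. by rewrite /pospart; case: ltP => // /ltW. Qed.

(** From $0$ to the norm-one matrix [E], smoothness bounds the change of gradient above;
    monotonicity with Cauchy-Schwarz bounds it below. *)
Lemma step_bounds : m <= D <= M.
Proof.
have E1 : fnorm E = 1 by rewrite /fnorm E_unit sqrtr1.
apply/andP; split; last first.
  by have := smooth (psdmx0 _ _) E_psd; rewrite sub0r fnormN E1 mulr1.
have := gradient_monotone (psdmx0 _ _) E_psd; rewrite subr0 E_unit mulr1.
move/le_trans; apply; apply: le_trans (fdot_le _ _) _.
by rewrite E1 mulr1 fnormBC.
Qed.

(** $P+G(0)$ is positive semidefinite, so its product with [X] is nonnegative; in the eigenbasis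
    this is [l i <= pospart i]. *)
Lemma fdot_projection_ge X : psdmx X -> fdot X (- G 0) <= fdot X P.
Proof.
move=> [_ Xp]; rewrite grad0 !fdot_spect; apply: ler_sum => i _.
by rewrite ler_wpM2r // /pospart; case: ltP.
Qed.

Lemma initialization_bound :
  fdot (D^-1 *: P - Xs) (D^-1 *: P - Xs)
    <= ((M / m) ^+ 2 - 2 / (M / m) + 1) * fdot Xs Xs.
Proof.
have /andP[mD DM] := step_bounds.
have D0 : 0 < D by apply: lt_le_trans mD.
have M0 : 0 < M by apply: lt_le_trans DM.
have P_psd : psdmx P by apply: spect_psd.
(* The direction [- Xs] is feasible: $X_s-tX_s=(1-t)X_s$ with $t\le1$. *)
have GXs : fdot (G Xs) Xs <= 0.
  rewrite -oppr_ge0 -fdotNr; apply: gradient_min_ge0 => t /andP[_ t1].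
  rewrite scalerN -[X in psdmx (X - _)]scale1r -scalerBl.
  by apply: psdmxZ => //; rewrite subr_ge0.
(* In $\langle G(X_s)-G(0),X_s\rangle-\langle G(X_s),X_s\rangle$, monotonicity bounds the first term
   below and the subtracted one is at most zero. *)
have PXs : m * fdot Xs Xs <= fdot P Xs.
  have := gradient_monotone (psdmx0 _ _) Xs_psd; rewrite subr0 => mono.
  have := fdot_projection_ge Xs_psd; rewrite (fdotC Xs P).
  move: mono; rewrite (fdotC Xs) !fdot_lin; move: GXs; lra.
(* The positive and negative parts of $-G(0)$ are orthogonal. *)
have PP : fdot P P = fdot (- G 0) P.
  rewrite grad0 /P !fdotE !tr_spect !mul_spect //; congr mxtrace.
  by apply: eq_spect => i; rewrite /pospart; case: ifP; rewrite ?mulr0.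
have GP : 0 <= fdot (G Xs) P.
  apply: gradient_min_ge0 => t /andP[t0 _].
  by apply: psdmxD => //; apply: psdmxZ => //; apply: ltW.
(* $|P|^2=\langle-G(0),P\rangle\le\langle G(X_s)-G(0),P\rangle\le M|X_s||P|$; then $|P|$ cancels
   unless it is zero. *)
have P_le : fdot P P <= M ^+ 2 * fdot Xs Xs.
  have sm : fnorm (G Xs - G 0) <= M * fnorm Xs.
    by have := smooth Xs_psd (psdmx0 _ _); rewrite subr0.
  have : fnorm P * fnorm P <= M * fnorm Xs * fnorm P.
    apply: le_trans (ler_wpM2r (fnorm_ge0 P) sm).
    rewrite -expr2 sqr_fnorm PP.
    by apply: le_trans (fdot_le _ _); rewrite fdotDl lerDr.
  have := fnorm_ge0 P; rewrite le_eqVlt => /orP[/eqP p0 _|p0].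
    by rewrite -sqr_fnorm -p0 expr0n mulr_ge0 ?sqr_ge0 ?fdot_ge0.
  rewrite ler_pM2r // => le.
  by rewrite -!sqr_fnorm -exprMn ler_pXn2r ?nnegrE ?mulr_ge0 ?fnorm_ge0 // ltW.
rewrite !fdot_lin (fdotC Xs P).
set p := fdot P P in P_le *; set q := fdot P Xs in PXs *.
have x0 := fdot_ge0 Xs; set x := fdot Xs Xs in P_le PXs x0 *.
(* The square term uses $D\ge m$, the cross term $D\le M$: hence $\kappa^2$ and $-2/\kappa$. *)
have b1 : D^-1 * (D^-1 * p) <= (M / m) ^+ 2 * x.
  have -> : (M / m) ^+ 2 * x = m^-1 ^+ 2 * (M ^+ 2 * x) by rewrite exprMn; ring.
  rewrite mulrA -expr2.
  apply: ler_pM; rewrite ?sqr_ge0 ?fdot_ge0 //.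
  by rewrite ler_pXn2r ?nnegrE ?invr_ge0 ?(ltW m0) ?(ltW D0) // lef_pV2.
have b2 : m / M * x <= D^-1 * q.
  apply: le_trans (_ : D^-1 * (m * x) <= _).
    rewrite mulrA ler_wpM2r // mulrC ler_wpM2r ?(ltW m0) // lef_pV2 //.
  by rewrite ler_wpM2l // invr_ge0 ltW.
have -> : 2 / (M / m) = 2 * (m / M) by rewrite invf_div.
move: b1 b2; lra.
Qed.

End Initialization.

(** * Transfer to the matrices of [Defs] *)

Definition toM p q (A : Mat p q) : 'M[R]_(p, q) := \matrix_(i, j) A i j.
Definition ofM p q (A : 'M[R]_(p, q)) : Mat p q := fun i j => A i j.

Lemma toMK p q : cancel (@toM p q) (@ofM p q).
Proof. by move=> A; apply/funext => i; apply/funext => j; rewrite /ofM mxE. Qed.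

Lemma ofMK p q : cancel (@ofM p q) (@toM p q).
Proof. by move=> A; apply/matrixP => i j; rewrite mxE. Qed.

Lemma toM_meq p q (A B : Mat p q) : meq A B -> toM A = toM B.
Proof. by move=> AB; apply/matrixP => i j; rewrite !mxE AB. Qed.

Lemma meq_toM p q (A B : Mat p q) : toM A = toM B -> meq A B.
Proof. by move=> /matrixP AB i j; have := AB i j; rewrite !mxE. Qed.

Lemma rsumE k (F : 'I_k -> R) : rsum F = \sum_i F i.
Proof. by []. Qed.

Lemma toM_mul p q s (A : Mat p q) (B : Mat q s) :
  toM (mmul A B) = toM A *m toM B.
Proof.
apply/matrixP => i j; rewrite !mxE /mmul rsumE.
by apply: eq_bigr => k _; rewrite !mxE.
Qed.

Lemma toM_tr p q (A : Mat p q) : toM (mtr A) = (toM A)^T.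
Proof. by apply/matrixP => i j; rewrite !mxE. Qed.

Lemma toM_sub p q (A B : Mat p q) : toM (msub A B) = toM A - toM B.
Proof. by apply/matrixP => i j; rewrite !mxE. Qed.

Lemma toM_opp p q (A : Mat p q) : toM (mopp A) = - toM A.
Proof. by apply/matrixP => i j; rewrite !mxE. Qed.

Lemma toM_scale p q c (A : Mat p q) : toM (mscale c A) = c *: toM A.
Proof. by apply/matrixP => i j; rewrite !mxE. Qed.

Lemma toM_zero p q : toM (@mzero p q) = 0.
Proof. by apply/matrixP => i j; rewrite !mxE. Qed.

Lemma toM_id k : toM (@mid k) = 1%:M.
Proof. by apply/matrixP => i j; rewrite !mxE /mid; case: eqP. Qed.

Lemma toM_diag k (l : 'I_k -> R) : toM (mdiag l) = diag_mx (\row_i l i).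
Proof. by apply/matrixP => i j; rewrite !mxE /mdiag; case: eqP => [->|]. Qed.

Lemma toM_spect k (V : Mat k k) l :
  toM (mmul (mmul V (mdiag l)) (mtr V)) = spect (toM V) l.
Proof. by rewrite !toM_mul toM_diag toM_tr. Qed.

Lemma toM_orth k (V : Mat k k) : is_orth V <-> (toM V)^T *m toM V = 1%:M.
Proof.
split=> [/toM_meq|VV]; first by rewrite toM_mul toM_tr toM_id.
by apply: meq_toM; rewrite toM_mul toM_tr toM_id.
Qed.

Lemma finnerE p q (A B : Mat p q) : finner A B = fdot (toM A) (toM B).
Proof. by apply: eq_bigr => i _; apply: eq_bigr => j _; rewrite !mxE. Qed.

Lemma frobE p q (A : Mat p q) : frob A = fnorm (toM A).
Proof. by rewrite /frob finnerE RsqrtE. Qed.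

Lemma toM_psd k (A : Mat k k) : is_psd A <-> psdmx (toM A).
Proof.
have form (v : 'I_k -> R) : rsum (fun i => rsum (fun j => (v i * A i j * v j)%R)) =
    fdot (\col_i v i) (toM A *m \col_i v i).
  rewrite /fdot; apply: eq_bigr => i _; rewrite big_ord1 !mxE mulr_sumr.
  by apply: eq_bigr => j _; rewrite !mxE mulrA.
split=> -[Asym Apos]; split.
- by apply/matrixP => i j; rewrite !mxE Asym.
- move=> v; have := Apos (fun i => v i 0); rewrite form => /RleP.
  by rewrite (_ : \col_i v i 0 = v) //; apply/colP => i; rewrite mxE.
- by move=> i j; have /matrixP/(_ j i) := Asym; rewrite !mxE.
- by move=> v; rewrite form; apply/RleP.
Qed.

Lemma nonincrP k (l : 'I_k -> R) :
  nonincr l <-> forall i j : 'I_k, (i <= j)%N -> l j <= l i.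
Proof. by split=> ldec i j ij; apply/RleP; apply: ldec. Qed.

(** The given decomposition shows that the predicate under [epsilon] is inhabited; uniqueness of the
    sorted spectrum identifies the choice. *)
Lemma eigvalsE k (S : Mat k k) (V : 'M[R]_k) (l : 'I_k -> R) :
    V^T *m V = 1%:M -> (forall i j : 'I_k, (i <= j)%N -> l j <= l i) ->
  toM S = spect V l -> eigvals S =1 l.
Proof.
move=> Vo ldec SV.
pose Q l' := exists V, is_eigdec S V l' /\ nonincr l'.
have [|W [[Wo SW] /nonincrP edec]] := epsilon_spec (inhabits (fun=> 0)) Q.
  exists l, (ofM V); split; last exact/nonincrP.
  split; first by apply/toM_orth; rewrite ofMK.
  by apply: meq_toM; rewrite toM_spect ofMK.
move: SW => /toM_meq; rewrite toM_spect SV => /esym SW.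
exact: (spect_inj (proj1 (toM_orth _) Wo) Vo edec ldec SW).
Qed.

Lemma svE p q (A : Mat p q) (V : 'M[R]_q) (l : 'I_q -> R) (i : 'I_q) k :
    V^T *m V = 1%:M -> (forall i j : 'I_q, (i <= j)%N -> l j <= l i) ->
    (toM A)^T *m toM A = spect V l -> i = k.-1 :> nat ->
  sv A k = Num.sqrt (l i).
Proof.
move=> Vo ldec AV ik; rewrite /sv -ik valK RsqrtE.
by rewrite (eigvalsE Vo ldec) // toM_mul toM_tr.
Qed.

(** Since $|VG|=|V|$, minimizing $|U-VG|$ means maximizing $\mathrm{tr}(U^TVG)$, and an attained
    maximum satisfies the predicate under [epsilon]. *)
Lemma Dist_spec n r (U V : Mat n r) :
  exists2 Q : 'M[R]_r, Q^T *m Q = 1%:M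
    & Dist U V = fnorm (toM U - toM V *m Q) /\ psdmx ((toM U)^T *m (toM V *m Q)).
Proof.
have dist2 (G : 'M[R]_r) : G^T *m G = 1%:M ->
    fdot (toM U - toM V *m G) (toM U - toM V *m G) =
    fdot (toM U) (toM U) + fdot (toM V) (toM V)
      - 2 * \tr ((toM U)^T *m toM V *m G).
  move=> /mulmx1C Go; rewrite !fdot_lin (fdotC (toM V *m G)) -mulmxA -fdotE.
  have -> : fdot (toM V *m G) (toM V *m G) = fdot (toM V) (toM V).
    by rewrite fdot_mulr -mulmxA Go mulmx1.
  ring.
pose Q d := (exists Q, is_orth Q /\ d = frob (msub U (mmul V Q))) /\
  forall Q, is_orth Q -> Rle d (frob (msub U (mmul V Q))).
have frob_diff W : frob (msub U (mmul V W)) = fnorm (toM U - toM V *m toM W).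
  by rewrite frobE toM_sub toM_mul.
have [|[W [/toM_orth Wo dW]] dmin] := epsilon_spec (inhabits R0) Q.
  have [W Wo Wmax] := orthogonal_trace_max ((toM U)^T *m toM V).
  exists (fnorm (toM U - toM V *m W)); split.
    exists (ofM W); split; first by apply/toM_orth; rewrite ofMK.
    by rewrite frob_diff ofMK.
  move=> G /toM_orth Go; apply/RleP; rewrite frob_diff ler_wsqrtr // !dist2 //.
  by have := Wmax _ Go; lra.
exists (toM W) => //; split; first by rewrite -frob_diff.
(* Comparing [W] with the competitors $WG$ shows that $\mathrm{tr}(U^TVWG)$ is largest at $G=1$. *)
rewrite mulmxA; apply: orthogonal_trace_max_psd => G Go.
have WGo : (toM W *m G)^T *m (toM W *m G) = 1%:M.
  by rewrite trmx_mul mulmxA -(mulmxA _ (toM W)^T) Wo mulmx1.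
have : epsilon (inhabits R0) Q <= fnorm (toM U - toM V *m (toM W *m G)).
  apply/RleP; rewrite -[_ *m G]ofMK -frob_diff; apply: dmin.
  by apply/toM_orth; rewrite ofMK.
rewrite dW frob_diff -(@ler_pXn2r _ 2) ?nnegrE ?fnorm_ge0 // !sqr_fnorm !dist2 //.
rewrite -!mulmxA; lra.
Qed.

(** [rank_ge] names [r] independent columns; as rows of the transpose they form a row-free
    submatrix. *)
Lemma rank_geP p q r (A : Mat p q) : rank_ge A r -> (r <= \rank (toM A))%N.
Proof.
case=> c cfree; have : row_free (rowsub c (toM A)^T).
  apply: inj_row_free => v v0; apply/rowP => t; rewrite mxE.
  apply: (cfree (fun t => v 0 t)) => i; move/rowP/(_ i): v0; rewrite !mxE => v0i.
  by apply: (etrans _ v0i); rewrite rsumE; apply: eq_bigr => k _; rewrite !mxE.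
by rewrite /row_free => /eqP <-; rewrite -(mxrank_tr (toM A)) mxrankS // rowsub_sub.
Qed.

Lemma toM_e11 n : toM (@e11 n.+1) = delta_mx 0 0.
Proof. by apply/matrixP => i j; rewrite !mxE /e11; case: ifP. Qed.

Lemma e11_psd n : psdmx (toM (@e11 n)).
Proof.
have -> : toM (@e11 n) = spect 1%:M (fun i => (i == 0 :> nat)%:R).
  rewrite /spect trmx1 mulmx1 mul1mx; apply/matrixP => i j; rewrite !mxE /e11.
  have [<-|ij] := eqVneq i j; first by rewrite andbb mulr1n; case: eqP.
  rewrite mulr0n; case: andP => // -[/eqP i0 /eqP j0].
  by case/eqP: ij; apply/val_inj; rewrite /= i0 j0.
by apply: spect_psd => i; rewrite ler0n.
Qed.

Lemma e11_unit n : (0 < n)%N -> fdot (toM (@e11 n)) (toM (@e11 n)) = 1.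
Proof.
case: n => // n _; rewrite toM_e11 /fdot (bigD1 0) //= (bigD1 0) //= !mxE /= mulr1.
rewrite !big1 ?addr0 // => [i i0|j j0]; last by rewrite !mxE (negPf j0) mulr0.
by rewrite big1 // => j _; rewrite !mxE (negPf i0) mulr0.
Qed.

(** Here [lam] and [sig] are $\sigma_r$ and $\sigma_1$ of [Xsr], and [k] is the rank. The hypotheses
    give a bound with $2\sqrt2$, which is weakened to $4\sqrt{2k}$. *)
Lemma Dist_bound_arith (F : rcfType) (d delta lam sig B k : F) :
    0 < lam -> 0 <= sig -> 0 <= B -> 0 <= d -> 0 <= delta -> 1 <= k ->
    lam * d ^+ 2 <= 2 * delta ^+ 2 -> delta <= 2 * (sig * B) ->
  d <= 4 * (sig / lam) * Num.sqrt (2 * k) * B * Num.sqrt lam.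
Proof.
move=> lam0 sig0 B0 d0 delta0 k1 dd deltaB.
have s0 : 0 < Num.sqrt lam by rewrite sqrtr_gt0.
have ds : Num.sqrt lam * d <= Num.sqrt 2 * delta.
  rewrite -(@ler_pXn2r _ 2) ?nnegrE ?mulr_ge0 ?sqrtr_ge0 //.
  by rewrite !exprMn !sqr_sqrtr // ltW.
have sk : Num.sqrt 2 <= Num.sqrt (2 * k) :> F.
  by rewrite ler_wsqrtr // ler_peMr.
rewrite -(ler_pM2l s0); apply: le_trans ds _.
have -> : Num.sqrt lam * (4 * (sig / lam) * Num.sqrt (2 * k) * B * Num.sqrt lam) =
    4 * (sig * B) * Num.sqrt (2 * k).
  have {2}-> : lam = Num.sqrt lam ^+ 2 by rewrite sqr_sqrtr // ltW.
  by field; rewrite gt_eqF.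
rewrite mulrC; apply: ler_pM; rewrite ?sqrtr_ge0 //.
by apply: le_trans deltaB _; rewrite ler_wpM2r ?mulr_ge0 // ler_nat.
Qed.

Lemma trunc_ge0 (F : rcfType) n r (l : 'I_n -> F) i :
  (forall i, 0 <= l i) -> 0 <= trunc r l i.
Proof. by move=> l0; rewrite /trunc; case: ifP. Qed.

Lemma trunc_nonincr (F : rcfType) n r (l : 'I_n -> F) :
    (forall i, 0 <= l i) -> (forall i j : 'I_n, (i <= j)%N -> l j <= l i) ->
  forall i j : 'I_n, (i <= j)%N -> trunc r l j <= trunc r l i.
Proof.
move=> l0 ldec i j ij; rewrite /trunc.
case: ifP => [jr|_]; first by rewrite (leq_ltn_trans ij jr) ldec.
by case: ifP.
Qed.

(** * The distance between the factors *)

Open Scope R_scope.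

Theorem theorem5p2 (n r : nat) (f : Mat n n -> R) (gf : Mat n n -> Mat n n)
  (M m rho : R) (Xs Xsr : Mat n n) (Usr : Mat n r)
  (P X0r : Mat n n) (U0 : Mat n r) :
  is_gradient f gf -> convex_fun f -> sym_fun f ->
  smooth_on_psd M gf -> strongly_convex_on_psd m f gf -> 0 < m ->
  is_psd Xs -> (forall Y, is_psd Y -> f Xs <= f Y) ->
  rank_ge Xs r ->
  is_best_rank_approx r Xs Xsr -> meq Xsr (mmul Usr (mtr Usr)) ->
  is_psd_proj (mopp (gf mzero)) P ->
  is_best_rank_approx r (mscale (/ frob (msub (gf mzero) (gf (@e11 n)))) P) X0r ->
  meq (mmul U0 (mtr U0)) X0r ->
  0 <= rho -> frob (msub Xs Xsr) <= rho * opnorm Xsr ->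
  let kappa := M / m in
  let gamma := 4 * tau Xsr r * sqrt (2 * INR r) *
     (sqrt (kappa ^ 2 - 2 / kappa + 1) * (sqrt (srank Xsr) + rho) + rho) in
  Dist U0 Usr <= gamma * sv Usr r.
Proof.
move=> _ _ _ smooth convex m0 Xs_psd Xs_min Xs_rank.
move=> [V [l [[Vo XsV] [ldec XsrV]]]] XsrU [V2 [l2 [[V2o gV2] PV2]]].
move=> [V3 [l3 [[V3o X0V3] [l3dec X0rV3]]]] U0X0r rho0 XsXsr kappa gamma.
have [Q Qo [-> UVpsd]] := Dist_spec U0 Usr.
(* With no columns the distance is zero, and [sv] takes its default value 0 as the index type is
   empty. *)
case: (posnP r) => [r0|r0].
  subst r; rewrite /sv; case: insubP => [[]//|_].
  rewrite (_ : toM U0 - toM Usr *m Q = 0)%R; last exact: thinmx0.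
  by rewrite fnorm0 Rmult_0_r; exact: Rle_refl.
Local Open Scope ring_scope.
move: Vo V2o V3o => /toM_orth Vo /toM_orth V2o /toM_orth V3o.
move: ldec l3dec => /nonincrP ldec /nonincrP l3dec.
move: XsV XsrV XsrU gV2 PV2 X0V3 X0rV3 U0X0r => /toM_meq XsV /toM_meq XsrV /toM_meq XsrU
  /toM_meq gV2 /toM_meq PV2 /toM_meq X0V3 /toM_meq X0rV3 /toM_meq U0X0r.
rewrite toM_spect in XsV; rewrite toM_spect in XsrV; rewrite toM_mul toM_tr in XsrU.
rewrite toM_opp toM_spect in gV2; rewrite toM_spect in PV2.
rewrite toM_mul toM_tr in U0X0r; rewrite toM_spect in X0rV3.
rewrite toM_spect toM_scale frobE toM_sub PV2 in X0V3.
pose F X := f (ofM X); pose G X := toM (gf (ofM X)).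
have G0 : toM (gf mzero) = G 0 by rewrite /G -(toM_zero n n) toMK.
have GE : toM (gf (@e11 n)) = G (toM (@e11 n)) by rewrite /G toMK.
rewrite G0 in gV2; rewrite G0 GE in X0V3.
have psdE X : psdmx X -> is_psd (ofM X) by move=> Xp; apply/toM_psd; rewrite ofMK.
have smoothG X Y : psdmx X -> psdmx Y -> fnorm (G X - G Y) <= M * fnorm (X - Y).
  move=> /psdE Xp /psdE Yp; have /RleP := smooth _ _ Xp Yp.
  by rewrite !frobE !toM_sub !ofMK.
have convexG X Y : psdmx X -> psdmx Y ->
    F X + fdot (G X) (Y - X) + m / 2 * fdot (Y - X) (Y - X) <= F Y.
  move=> /psdE Xp /psdE Yp; have /Rge_le/RleP := convex _ _ Xp Yp.
  rewrite frobE finnerE toM_sub !ofMK RpowE sqr_fnorm !RealsE.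
  by [].
have {}m0 : 0 < m by apply/RltP.
have XsP : psdmx (toM Xs) by apply/toM_psd.
have XsMin Y : psdmx Y -> F (toM Xs) <= F Y.
  by move=> /psdE Yp; apply/RleP; rewrite /F toMK; apply: Xs_min.
have l0 : forall i, 0 <= l i by apply: (psd_spect_ge0 Vo); rewrite -XsV.
(* The rank makes the eigenvalue at zero-based position $r-1$ positive; it will be $\sigma_r$ of
   [Xsr]. *)
have rankXs : (0 < r <= \rank (spect (toM V) l))%N by rewrite r0 -XsV rank_geP.
have [i0 i0E li0] := rank_spect_pos rankXs l0 ldec.
have rn : (r <= n)%N by rewrite -(prednK r0) -i0E.
have n0 : (0 < n)%N by apply: leq_trans rn.
pose i1 := Ordinal n0.
have X0_bound := initialization_bound smoothG convexG m0 XsP XsMin V2o gV2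
  (e11_psd n) (e11_unit n0).
have /andP[mD _] := step_bounds smoothG convexG (e11_psd n) (e11_unit n0).
set D := fnorm (G 0 - G _) in X0_bound mD X0V3.
have D0 : 0 < D by apply: lt_le_trans mD.
set pos := (fun i => if 0 < l2 i then l2 i else 0) in X0_bound.
rewrite (eq_spect (toM V2) (l' := pos)) in X0V3; last first.
  by move=> i; rewrite /pos; case: Rlt_dec => /= [/RltP ->|/RltP/negPf ->].
have {}X0V3 : D^-1 *: spect (toM V2) pos = spect (toM V3) l3 by [].
rewrite X0V3 in X0_bound; set X0 := spect (toM V3) l3 in X0V3 X0_bound.
have l30 : forall i, 0 <= l3 i.
  apply: (psd_spect_ge0 V3o); rewrite -/X0 -X0V3; apply: psdmxZ.
    by rewrite invr_ge0 ltW.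
  by apply: spect_psd => i; rewrite /pos; case: ltP => // /ltW.
rewrite -[RHS]/(spect _ (trunc r l)) in XsrV.
rewrite -[RHS]/(spect _ (trunc r l3)) in X0rV3.
have i0r : (i0 < r)%N by rewrite i0E prednK.
(* Singular values of [Xsr] are read off its square; nonnegativity keeps the squared eigenvalues
   sorted. *)
have sq_dec (i j : 'I_n) : (i <= j)%N ->
    trunc r l j * trunc r l j <= trunc r l i * trunc r l i.
  by move=> ij; apply: ler_pM; rewrite ?trunc_ge0 // trunc_nonincr.
have XX : (toM Xsr)^T *m toM Xsr =
    spect (toM V) (fun i => trunc r l i * trunc r l i).
  by rewrite XsrV tr_spect mul_spect.
have sv_i (i : 'I_n) k : (i < r)%N -> i = k.-1 :> nat -> sv Xsr k = l i.
  move=> ir ik; rewrite (svE Vo sq_dec XX ik) -expr2 sqrtr_sqr.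
  by rewrite ger0_norm ?trunc_ge0 // /trunc ir.
have svr : sv Xsr r = l i0 by apply: sv_i.
have sv1 : sv Xsr 1 = l i1 by apply: sv_i.
have lr (i : 'I_n) : (i < r)%N -> 0 < l i.
  by move=> ir; apply: lt_le_trans li0 _; rewrite ldec // i0E -ltnS prednK.
(* The Gram matrix of [Usr] has the [r] leading eigenvalues of [Xs]: this yields both $\sigma_r$ of
   [Usr] and the lower bound for the Procrustes estimate. *)
have [W Wo UW] := gram_spect rn Vo lr (etrans (esym XsrU) XsrV).
have ur : (r.-1 < r)%N by rewrite prednK.
have wi0 : widen_ord rn (Ordinal ur) = i0 by apply: val_inj; rewrite /= i0E.
have wdec (i j : 'I_r) : (i <= j)%N ->
    (l \o widen_ord rn) j <= (l \o widen_ord rn) i.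
  by move=> ij; apply: ldec.
have svU : sv Usr r = Num.sqrt (l i0).
  by rewrite (svE (i := Ordinal ur) (k := r) Wo wdec UW) //= wi0.
have U_ge (x : 'cV_r) :
    l i0 * fdot x x <= fdot (toM Usr *m Q *m x) (toM Usr *m Q *m x).
  rewrite -mulmxA fdot_mull (mulmxA (toM Usr)^T) UW -(fdot_orth x x Qo).
  apply: spect_ge => // i.
  by rewrite -wi0; apply: wdec; rewrite /= -ltnS prednK.
(* [Q] cancels in $(UQ)(UQ)^T$, which leaves [X0r] against [Xsr]. *)
have := procrustes_le UVpsd U_ge.
rewrite trmx_mul mulmxA -(mulmxA (toM Usr)) (mulmx1C Qo) mulmx1 -XsrU U0X0r.
rewrite -!sqr_fnorm => dist2.
pose a := (M / m) ^+ 2 - 2 / (M / m) + 1.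
(* The square root of [srank Xsr], as [l i1] is the operator norm. *)
pose sr := fnorm (toM Xsr) / l i1.
have li1 : 0 < l i1 by apply: lt_le_trans li0 (ldec _ _ _).
have srE : Num.sqrt (fnorm (toM Xsr) ^+ 2 / l i1 ^+ 2) = sr.
  by rewrite -expr_div_n sqrtr_sqr ger0_norm // divr_ge0 ?fnorm_ge0 ?ltW.
have XsXsr' : fnorm (toM Xs - toM Xsr) <= rho * l i1.
  by move/RleP: XsXsr; rewrite frobE toM_sub /opnorm sv1.
have X0Xs : fnorm (X0 - toM Xs) <= Num.sqrt a * fnorm (toM Xs).
  rewrite mulrC /fnorm -sqrtrM ?fdot_ge0 // ler_wsqrtr // mulrC.
  exact: X0_bound.
(* [Xsr] is itself a truncation after [r] eigenvalues, hence a competitor of [X0r]. *)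
have EY : fnorm (X0 - toM X0r) <= fnorm (X0 - toM Xsr).
  rewrite X0rV3 XsrV ler_wsqrtr //; exact: (eckart_young _ V3o Vo i0E).
have {}rho0 : 0 <= rho by apply/RleP.
have B0 : 0 <= Num.sqrt a * (sr + rho) + rho.
  by rewrite addr_ge0 // mulr_ge0 ?sqrtr_ge0 // addr_ge0 // divr_ge0 ?fnorm_ge0 ?ltW.
(* Three triangle inequalities: through [X0], where Eckart-Young doubles $|X_0-X_{sr}|$; through
   [Xs]; and $|X_s|\le|X_s-X_{sr}|+|X_{sr}|$. *)
have delta_le : fnorm (toM X0r - toM Xsr) <=
    2 * (l i1 * (Num.sqrt a * (sr + rho) + rho)).
  have t1 := fnorm_triangle (toM X0r) X0 (toM Xsr).
  have t2 := fnorm_triangle X0 (toM Xs) (toM Xsr).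
  have t3 := fnorm_triangle (toM Xs) (toM Xsr) 0; rewrite !subr0 in t3.
  rewrite (fnormBC _ X0) in t1.
  have srX : l i1 * sr = fnorm (toM Xsr) by rewrite mulrC divfK // gt_eqF.
  have t4 : Num.sqrt a * fnorm (toM Xs) <= Num.sqrt a * (l i1 * sr + rho * l i1).
    rewrite srX ler_wpM2l ?sqrtr_ge0 //; apply: le_trans t3 _.
    by rewrite addrC lerD2l.
  have -> : l i1 * (Num.sqrt a * (sr + rho) + rho) =
      Num.sqrt a * (l i1 * sr + rho * l i1) + rho * l i1 by ring.
  apply: le_trans t1 _; rewrite mulr_natl mulr2n.
  have t5 : fnorm (X0 - toM Xsr) <=
      Num.sqrt a * (l i1 * sr + rho * l i1) + rho * l i1.
    by apply: le_trans t2 _; apply: lerD => //; apply: le_trans X0Xs t4.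
  by apply: lerD => //; apply: le_trans EY t5.
have r1 : 1 <= r%:R :> R by rewrite ler1n.
have H := Dist_bound_arith li0 (ltW li1) B0 (fnorm_ge0 _) (fnorm_ge0 _) r1 dist2 delta_le.
apply/RleP; rewrite /gamma /tau /kappa /srank /opnorm frobE svr sv1 svU.
rewrite -srE in H; rewrite !RsqrtE !RpowE INRE !RealsE; exact: H.
Qed.
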